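(* Let $\cong$ be a congruence on LTSs such that $L\doteq L'$ implies $L\cong L'$, and $\cong$ preserves $\mathit{Sf}$, $\mathit{minD}$ and $\mathit{Inf}$ but does not preserve $\mathit{Div}$. Then $\cong$ is the equivalence induced by $\Sigma$, $\mathit{Tr}$, $\mathit{Sf}$, $\mathit{minD}$ and $\mathit{Inf}$.
   Context: An LTS is a tuple $L=(S,\Sigma,\Delta,\hat s)$ with states $S$, alphabet $\Sigma$ (possibly infinite), $\tau\notin\Sigma$ a reserved invisible action, transitions $\Delta\subseteq S\times(\Sigma\cup\{\tau\})\times S$, initial state $\hat s$; $\Sigma(L)$ denotes the alphabet. Operators: action prefix $a.L$ ($a\neq\tau$): new initial state $\hat s'$, alphabet $\Sigma\cup\{a\}$, transitions $\Delta\cup\{(\hat s',a,\hat s)\}$. Hiding $L\setminus A$: alphabet $\Sigma\setminus A$, each transition labelled by an element of $A$ relabelled $\tau$, otherwise unchanged. Relational renaming $L\Phi$ ($\Phi$ a set of pairs, $\tau$ not in its domain $\mathcal D(\Phi)$ or range; $\Phi(a,b)$ means $(a,b)\in\Phi$ or $a=b\notin\mathcal D(\Phi)$): alphabet $\{b\mid\exists a\in\Sigma:\Phi(a,b)\}$, transitions $\{(s,b,s')\mid\exists a:(s,a,s')\in\Delta\wedge\Phi(a,b)\}$, same states and initial state. Parallel composition $L_1\|L_2$: states $S_1\times S_2$, alphabet $\Sigma_1\cup\Sigma_2$, initial $(\hat s_1,\hat s_2)$; actions in $\Sigma_1\cap\Sigma_2$ are taken jointly by both components, all other actions (including $\tau$)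 by one component while the other stays put. A congruence is an equivalence $\cong$ with $L\cong L'\Rightarrow a.L\cong a.L',\ L\setminus A\cong L'\setminus A,\ L\Phi\cong L'\Phi,\ L\|L''\cong L'\|L'',\ L''\|L\cong L''\|L'$. For $\sigma=a_1\cdots a_n\in\Sigma^*$, $s\stackrel{\sigma}{\Rightarrow}s'$ means a finite path from $s$ to $s'$ whose non-$\tau$ labels are exactly $a_1,\dots,a_n$ in order; $\hat s\stackrel{\xi}{\Rightarrow}$ for $\xi\in\Sigma^\omega$ means an infinite path from $\hat s$ whose non-$\tau$ label sequence is $\xi$; $s\stackrel{\tau^\omega}{\to}$ means an infinite path of $\tau$-transitions from $s$. Define $\mathit{Tr}(L)=\{\sigma\in\Sigma^*\mid\exists s:\hat s\stackrel\sigma\Rightarrow s\}$, $\mathit{Div}(L)=\{\sigma\in\Sigma^*\mid\exists s:\hat s\stackrel\sigma\Rightarrow s\wedge s\stackrel{\tau^\omega}\to\}$, $\mathit{Inf}(L)=\{\xi\in\Sigma^\omega\mid\hat s\stackrel\xi\Rightarrow\}$, $\mathit{Sf}(L)=\{(\sigma,A)\in\Sigma^*\times2^\Sigma\mid\exists s:\hat s\stackrel\sigma\Rightarrow s\wedge\forall a\in A\cup\{\tau\}\,\forall s':(s,a,s')\notin\Delta\}$, and $\mathit{minD}(L)=\{a_1\cdots a_n\in\mathit{Div}(L)\mid\forall i,0\le i<n: a_1\cdots a_i\notin\mathit{Div}(L)\}$. $L\doteq L'$ (CFFD-equivalence) iff $\Sigma,\mathit{Sf},\mathit{Div},\mathit{Inf}$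 all agree on $L$ and $L'$. An equivalence preserves $X$ if $L\cong L'\Rightarrow X(L)=X(L')$; the equivalence induced by $\Sigma,X_1,\dots,X_k$ relates $L,L'$ iff all these functions agree on them. *)

(* Defs.v *)
From Stdlib Require Import RelationClasses.
From mathcomp Require Import all_boot.
From mathcomp Require Import boolp classical_sets functions cardinality.

Set Implicit Arguments.
Unset Strict Implicit.
Unset Printing Implicit Defensive.

Local Open Scope classical_set_scope.

(* [Act] is the universe of visible actions; a label is an [option Act], with
   [None] playing the role of tau, so that tau is never in an alphabet. *)
Record lts (Act : Type) := Lts {
  state : Type;
  alphabet : set Act;
  trans : state -> option Act -> state -> Prop;
  init : state;
  trans_alphabet : forall s a s', trans s (Some a) s' -> alphabet a
}.

Section Operators.
Variable Act : Type.
Implicit Types (L : lts Act) (a b : Act) (A : set Act) (Phi : set (Act * Act)).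

(* The new initial state is [None]; the old states are the [Some s]. *)
Definition prefix_trans a L (s : option (state L)) (l : option Act)
    (s' : option (state L)) : Prop :=
  match s, s' with
  | Some t, Some t' => trans t l t'
  | None, Some t' => l = Some a /\ t' = init L
  | _, None => False
  end.

Lemma prefix_trans_alphabet a L s b s' :
  @prefix_trans a L s (Some b) s' -> (alphabet L `|` [set a]) b.
Proof.
case: s s' => [s|] [s'|] //= H; first by left; apply: trans_alphabet H.
by case: H => -[->] _; right.
Qed.

Definition act_prefix a L : lts Act :=
  {| state := option (state L);
     alphabet := alphabet L `|` [set a];
     trans := @prefix_trans a L;
     init := None;
     trans_alphabet := @prefix_trans_alphabet a L |}.

Definition hide_trans L A (s : state L) (l : option Act) (s' : state L) : Prop :=
  match l with
  | Some a => trans s (Some a) s' /\ ~ A a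
  | None => trans s None s' \/ exists2 a, A a & trans s (Some a) s'
  end.

Lemma hide_trans_alphabet L A s a s' :
  @hide_trans L A s (Some a) s' -> (alphabet L `\` A) a.
Proof. by case=> H nAa; split=> //; apply: trans_alphabet H. Qed.

Definition hiding L A : lts Act :=
  {| state := state L;
     alphabet := alphabet L `\` A;
     trans := @hide_trans L A;
     init := init L;
     trans_alphabet := @hide_trans_alphabet L A |}.

Definition renames Phi a b : Prop :=
  Phi (a, b) \/ (a = b /\ ~ exists c, Phi (a, c)).

Definition rename_trans L Phi (s : state L) (l : option Act) (s' : state L)
    : Prop :=
  match l with
  | Some b => exists2 a, trans s (Some a) s' & renames Phi a b
  | None => trans s None s'
  end.

Lemma rename_trans_alphabet L Phi s b s' :
  @rename_trans L Phi s (Some b) s' ->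
  [set c | exists2 a, alphabet L a & renames Phi a c] b.
Proof. by case=> a H ab; exists a => //; apply: trans_alphabet H. Qed.

Definition renaming L Phi : lts Act :=
  {| state := state L;
     alphabet := [set b | exists2 a, alphabet L a & renames Phi a b];
     trans := @rename_trans L Phi;
     init := init L;
     trans_alphabet := @rename_trans_alphabet L Phi |}.

Definition joint L1 L2 (l : option Act) : Prop :=
  if l is Some a then alphabet L1 a /\ alphabet L2 a else False.

Definition par_trans L1 L2 (s : state L1 * state L2) (l : option Act)
    (s' : state L1 * state L2) : Prop :=
  (joint L1 L2 l /\ (trans s.1 l s'.1 /\ trans s.2 l s'.2)) \/
  (~ joint L1 L2 l /\
    ((trans s.1 l s'.1 /\ s'.2 = s.2) \/ (s'.1 = s.1 /\ trans s.2 l s'.2))).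

Lemma par_trans_alphabet L1 L2 s a s' :
  @par_trans L1 L2 s (Some a) s' -> (alphabet L1 `|` alphabet L2) a.
Proof.
case=> [[[La _] _]|[_ [[H _]|[_ H]]]]; first by left.
- by left; apply: trans_alphabet H.
- by right; apply: trans_alphabet H.
Qed.

Definition parallel L1 L2 : lts Act :=
  {| state := state L1 * state L2;
     alphabet := alphabet L1 `|` alphabet L2;
     trans := @par_trans L1 L2;
     init := (init L1, init L2);
     trans_alphabet := @par_trans_alphabet L1 L2 |}.

End Operators.

Record congruence (Act : Type) (R : lts Act -> lts Act -> Prop) : Prop := {
  congr_equiv : Equivalence R;
  congr_prefix : forall a L L', R L L' -> R (act_prefix a L) (act_prefix a L');
  congr_hiding : forall A L L', R L L' -> R (hiding L A) (hiding L' A);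
  congr_renaming :
    forall Phi L L', R L L' -> R (renaming L Phi) (renaming L' Phi);
  congr_parl : forall L'' L L', R L L' -> R (parallel L L'') (parallel L' L'');
  congr_parr : forall L'' L L', R L L' -> R (parallel L'' L) (parallel L'' L')
}.

Section Semantics.
Variables (Act : Type) (L : lts Act).
Implicit Types (s : state L) (sigma : seq Act) (xi : nat -> Act).

Fixpoint fin_path s (ls : seq (option Act)) s' : Prop :=
  if ls is l :: ls' then exists2 t, trans s l t & fin_path t ls' s'
  else s = s'.

(* [pmap id] deletes the tau labels. *)
Definition weak_path s sigma s' : Prop :=
  exists2 ls, pmap id ls = sigma & fin_path s ls s'.

Definition inf_path (p : nat -> state L) (l : nat -> option Act) : Prop :=
  forall i, trans (p i) (l i) (p i.+1).

Definition diverges s : Prop :=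
  exists2 p, p 0 = s & inf_path p (fun=> None).

(* [e n] is the position of the n-th visible label of [l]. *)
Definition visible_word (l : nat -> option Act) xi : Prop :=
  exists e : nat -> nat,
    [/\ forall n, e n < e n.+1,
        forall n, l (e n) = Some (xi n) &
        forall i, (forall n, i <> e n) -> l i = None].

(* By [trans_alphabet], only words over [alphabet L] occur below. *)
Definition Tr : set (seq Act) :=
  [set sigma | exists s, weak_path (init L) sigma s].

Definition Div : set (seq Act) :=
  [set sigma | exists2 s, weak_path (init L) sigma s & diverges s].

Definition Inf : set (nat -> Act) :=
  [set xi | exists p l,
    [/\ p 0 = init L, inf_path p l & visible_word l xi]].

Definition Sf : set (seq Act * set Act) :=
  [set sA | sA.2 `<=` alphabet L /\
    exists2 s, weak_path (init L) sA.1 s &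
      (forall s', ~ trans s None s') /\
      (forall a s', sA.2 a -> ~ trans s (Some a) s')].

Definition minD : set (seq Act) :=
  [set sigma | Div sigma /\ forall i, i < size sigma -> ~ Div (take i sigma)].

End Semantics.

Definition cffd_equiv (Act : Type) (L L' : lts Act) : Prop :=
  [/\ alphabet L = alphabet L', Sf L = Sf L', Div L = Div L' & Inf L = Inf L'].

Definition preserves (Act T : Type) (R : lts Act -> lts Act -> Prop)
    (X : lts Act -> T) : Prop :=
  forall L L', R L L' -> X L = X L'.

(* Main.v *)
(* Let delta be a divergence trace of P but not of P', where P and P' are
   related. Wrapping X = P, P' in a context makes it run along delta under a
   single fresh action [mark]; call the result Q(X). Composing Q(X) with a
   controller built from a given L, and hiding [mark], yields a system that can
   run L, and that at any divergent state of L may instead execute delta inside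
   X (while diverging by itself, which is harmless there) and then go on with
   any visible continuation allowed by Tr(L), able to return to L at every
   moment. Neither Sf nor Inf changes. If X = P', nothing changes at all up to
   CFFD-equivalence, because after delta X cannot diverge; if X = P, every trace
   of L extending a divergence trace becomes a divergence trace. So L is related
   to a system whose CFFD semantics depends only on Sigma, Tr, Sf, minD and
   Inf. *)
Require Import Defs.
From Stdlib Require List.
From mathcomp Require Import all_boot.
From mathcomp Require Import boolp classical_sets functions cardinality.

Set Implicit Arguments.
Unset Strict Implicit.
Unset Printing Implicit Defensive.

Local Open Scope classical_set_scope.

(** Dependent choice along an invariant: outside [P] the chosen successor is arbitrary, which makes
    the choice function total. *)
Lemma dependent_choice_inv (X : Type) (P : X -> Prop) (S : X -> X -> Prop) x0 :
  P x0 -> (forall x, P x -> exists2 y, S x y & P y) ->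
  exists f : nat -> X, [/\ f 0 = x0, forall n, P (f n) &
    forall n, S (f n) (f n.+1)].
Proof.
move=> Px0 step.
have [|h hP] := @choice X X (fun x y => P x -> S x y /\ P y).
  move=> x; have [Px|nPx] := EM (P x); last by exists x.
  by have [y Sxy Py] := step x Px; exists y.
have Pf n : P (iter n h x0) by elim: n => //= n /hP[].
by exists (fun n => iter n h x0); split=> // n; have [] := hP _ (Pf n).
Qed.

(** * Finite paths, weak paths and divergence *)

Section Paths.
Variables (Act : Type) (L : lts Act).
Implicit Types (s t : state L) (ls : seq (option Act)) (sigma rho : seq Act).

Lemma fin_path_cat s ls ls' s' :
  fin_path s (ls ++ ls') s' <->
  exists2 t, fin_path s ls t & fin_path t ls' s'.
Proof.
elim: ls s => [|l ls IH] s /=.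
  by split=> [H|[_ <-]//]; exists s.
split=> [[t st /IH[u tu us']]|[u [t st tu] us']].
  by exists u => //; exists t.
by exists t => //; apply/IH; exists u.
Qed.

Lemma weak_path0 s : weak_path s [::] s.
Proof. by exists [::]. Qed.

Lemma weak_path_cat s t s' sigma rho :
  weak_path s sigma t -> weak_path t rho s' -> weak_path s (sigma ++ rho) s'.
Proof.
move=> [ls <- st] [ls' <- ts']; exists (ls ++ ls'); first by rewrite pmap_cat.
by apply/fin_path_cat; exists t.
Qed.

Lemma weak_path_tau s t : trans s None t -> weak_path s [::] t.
Proof. by move=> st; exists [:: None] => //=; exists t. Qed.

Lemma weak_path_vis s x t : trans s (Some x) t -> weak_path s [:: x] t.
Proof. by move=> st; exists [:: Some x] => //=; exists t. Qed.

Lemma weak_path_taur s sigma t s' :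
  weak_path s sigma t -> trans t None s' -> weak_path s sigma s'.
Proof.
by move=> st /weak_path_tau ts'; rewrite -[sigma]cats0; apply: weak_path_cat ts'.
Qed.

Lemma weak_path_visr s sigma t x s' :
  weak_path s sigma t -> trans t (Some x) s' ->
  weak_path s (rcons sigma x) s'.
Proof.
by move=> st /weak_path_vis ts'; rewrite -cats1; apply: weak_path_cat ts'.
Qed.

Lemma weak_path_split s sigma rho s' :
  weak_path s (sigma ++ rho) s' ->
  exists2 t, weak_path s sigma t & weak_path t rho s'.
Proof.
case=> ls; elim: ls s sigma => [|l ls IH] s sigma /=.
  by case: sigma => //= <- <-; exists s => //; exact: weak_path0.
case: l => [x|] /= eq_ls [u su us'].
  case: sigma eq_ls => [|y sigma] /= eq_ls.
    exists s; [exact: weak_path0|exists (Some x :: ls) => //=; by exists u].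
  case: eq_ls => <- /IH/(_ us')[t ut ts']; exists t => //.
  exact: weak_path_cat (weak_path_vis su) ut.
have [t ut ts'] := IH _ _ eq_ls us'.
by exists t => //; exact: weak_path_cat (weak_path_tau su) ut.
Qed.

(** Induction at the right end of the path, so that [I] can be an invariant relating the word
    performed so far to the state reached. *)
Lemma weak_path_ind s (I : seq Act -> state L -> Prop) :
  I [::] s ->
  (forall sigma t t', I sigma t -> trans t None t' -> I sigma t') ->
  (forall sigma t x t',
    I sigma t -> trans t (Some x) t' -> I (rcons sigma x) t') ->
  forall sigma t, weak_path s sigma t -> I sigma t.
Proof.
move=> I0 Itau Ivis sigma t [ls <-]; elim/last_ind: ls t => [|ls l IH] t.
  by move=> <-.
rewrite -cats1 pmap_cat => /fin_path_cat[u /IH Iu] /= [v uv <-].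
case: l uv => [x|] uv /=; last by rewrite cats0; apply: Itau uv.
by rewrite cats1; apply: Ivis uv.
Qed.

Lemma Tr_prefix sigma rho : Tr L (sigma ++ rho) -> Tr L sigma.
Proof. by case=> s /weak_path_split[t st _]; exists t. Qed.

Lemma Div_Tr sigma : Div L sigma -> Tr L sigma.
Proof. by case=> s ? _; exists s. Qed.

Lemma diverges_step s :
  diverges s -> exists2 t, trans s None t & diverges t.
Proof.
move=> [p <- pP]; exists (p 1); first exact: pP 0.
by exists (fun i => p i.+1) => // i; exact: pP.
Qed.

Lemma diverges_coind (I : state L -> Prop) s :
  I s -> (forall t, I t -> exists2 u, trans t None u & I u) -> diverges s.
Proof. by move=> Is /(dependent_choice_inv Is)[p [p0 _ pP]]; exists p. Qed.

Lemma Tr_alphabet sigma y :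
  Tr L sigma -> List.In y sigma -> alphabet L y.
Proof.
case=> s sP /(@List.in_split _ y)[u [v eq_sigma]]; move: sP; rewrite eq_sigma.
move=> /weak_path_split[t _]; rewrite -cat1s.
move=> /weak_path_split[t' [ls lsP] lsT _].
elim: ls t lsP lsT => //= -[x|] ls IH t /= lsP [w tw wt']; last exact: IH wt'.
by case: lsP tw => -> _ tw; apply: trans_alphabet tw.
Qed.

End Paths.

(** * Visible words of infinite label sequences *)

Section VisibleWords.
Variable Act : Type.
Implicit Types (l : nat -> option Act) (xi : nat -> Act).

Lemma pmap_mkseqS l i :
  pmap id (mkseq l i.+1) = pmap id (mkseq l i) ++ pmap id [:: l i].
Proof. by rewrite mkseqS -cats1 pmap_cat. Qed.

Lemma mkseq_prefix xi u v n : u ++ v = mkseq xi n -> u = mkseq xi (size u).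
Proof.
move=> uv; have := congr1 (take (size u)) uv; rewrite take_size_cat // => ->.
rewrite size_takel ?size_mkseq; last first.
  by rewrite -(size_mkseq xi n) -uv size_cat leq_addr.
rewrite /mkseq -map_take take_iota; congr (map _ (iota _ _)); apply/minn_idPl.
by rewrite -(size_mkseq xi n) -uv size_cat leq_addr.
Qed.

(** Trades the position function for finite prefixes: their visible contents are prefixes of [xi] of
    unbounded length. *)
Lemma visible_wordP l xi :
  visible_word l xi <->
  (forall i, exists n, pmap id (mkseq l i) = mkseq xi n) /\
  (forall n, exists i, n <= size (pmap id (mkseq l i))).
Proof.
split=> [[e [eS eV eN]]|[lxi unb]].
  have e_homo : {homo e : m n / m < n} by exact: (homo_ltn ltn_trans).
  have e_mono : {mono e : m n / m <= n} by exact: leq_mono.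
  (* Here [n] is the number of positions [e m] lying below [i]. *)
  have count i : exists2 n, pmap id (mkseq l i) = mkseq xi n &
                            forall m, (e m < i) = (m < n).
    elim: i => [|i [n IHn IHe]]; first by exists 0.
    rewrite pmap_mkseqS IHn.
    have [[m em]|noe] := EM (exists m, i = e m).
      have mn : m = n.
        apply/eqP; rewrite eqn_leq [n <= m]leqNgt -IHe em ltnn andbT leqNgt.
        by apply/negP => /e_homo; rewrite -em IHe ltnn.
      exists n.+1; first by rewrite em eV mn mkseqS cats1.
      by move=> m'; rewrite em mn !ltnS e_mono.
    exists n; first by rewrite (eN i) ?cats0 // => m im; apply: noe; exists m.
    move=> m; rewrite ltnS leq_eqVlt IHe; case: eqP => // em.
    by case: noe; exists m.
  split=> [i|n]; first by have [n ->] := count i; exists n.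
  exists (e n).+1; have [m -> mP] := count (e n).+1.
  by rewrite size_mkseq ltnW // -mP.
pose c i := size (pmap id (mkseq l i)).
have cS i : c i.+1 = c i + isSome (l i).
  by rewrite /c pmap_mkseqS size_cat; case: (l i).
have c_le : {homo c : i j / i <= j}.
  by apply: homo_leq => // [j i k|i]; [exact: leq_trans|rewrite cS leq_addr].
have lP i y : l i = Some y -> y = xi (c i).
  move=> li; have [n] := lxi i.+1; rewrite pmap_mkseqS li /= cats1 => E.
  have [m Em] := lxi i; have nm : n = m.+1.
    by rewrite -(size_mkseq xi n) -E size_rcons Em size_mkseq.
  move: E; rewrite nm mkseqS => /rcons_inj[_ ->].
  by rewrite /c Em size_mkseq.
have e_ex n : exists i, n < c i by exact: unb.
(* The least [i] with [n < c i] is positive since [c 0 = 0]; the count rises from [n] at its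
   predecessor, which is thus the position of the [n]-th visible label. *)
pose e n := (ex_minn (e_ex n)).-1.
have eP n : c (e n) = n /\ l (e n) <> None.
  rewrite /e; case: ex_minnP => -[|i] //= nc imin.
  have ci : c i <= n.
    by rewrite leqNgt; apply/negP => /imin; rewrite ltnn.
  move: nc; rewrite cS; case: (l i) => [y|] /=; last first.
    by rewrite addn0 ltnNge ci.
  by rewrite addn1 ltnS => nc; split=> //; apply/eqP; rewrite eqn_leq ci.
exists e; split=> [n|n|i noe].
- rewrite ltnNge; apply/negP => /c_le.
  by rewrite (eP n).1 (eP n.+1).1 ltnn.
- have [cn] := eP n; case E: (l (e n)) => [y|] // _.
  by rewrite (lP _ _ E) cn.
case E: (l i) => [y|] //; case: (noe (c i)); apply/eqP.
have [cE lE] := eP (c i); rewrite eqn_leq; apply/andP; split; rewrite leqNgt.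
  apply/negP => /c_le; rewrite cS cE.
  by case: (l _) lE => // z _; rewrite addn1 ltnn.
by apply/negP => /c_le; rewrite cS cE E addn1 ltnn.
Qed.
End VisibleWords.

(** * Infinite traces as sequences of one-letter weak steps *)

Section InfiniteWords.
Variables (Act : Type) (L : lts Act).
Implicit Types (s t : state L) (xi : nat -> Act).

Lemma Inf_weak_steps xi :
  Inf L xi -> exists t : nat -> state L,
    t 0 = init L /\ forall n, weak_path (t n) [:: xi n] (t n.+1).
Proof.
move=> [p [l [p0 pP [e [eS eV eN]]]]].
have p_path i j ls : pmap id (mkseq (fun k => l (i + k)) j) = ls ->
    weak_path (p i) ls (p (i + j)).
  move=> <-; elim: j => [|j IH]; first by rewrite addn0; exact: weak_path0.
  rewrite pmap_mkseqS; apply: weak_path_cat IH _; rewrite addnS.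
  have := pP (i + j); case: (l _) => [x|] /=; first exact: weak_path_vis.
  exact: weak_path_tau.
(* The run is cut just after each visible label: between [d n] and [e n] there are only taus. *)
pose d n := if n is m.+1 then (e m).+1 else 0.
have d_le n : d n <= e n by case: n => //= n; exact: eS.
have tau_between n i : d n <= i -> i < e n -> l i = None.
  have e_homo : {homo e : m n / m < n} by exact: (homo_ltn ltn_trans).
  move=> dn ne; apply: eN => m im; move: dn ne; rewrite im.
  rewrite (leqW_mono (leq_mono e_homo)) => + mn; case: n mn => //= n mn.
  rewrite (leqW_mono (leq_mono e_homo)) => nm.
  by have := leq_trans mn nm; rewrite ltnn.
exists (p \o d); split=> //= n.
have -> : [:: xi n] = rcons [::] (xi n) by [].
apply: (@weak_path_visr _ _ _ _ (p (e n))); last by rewrite -eV; exact: pP.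
rewrite -(subnKC (d_le n)); apply: p_path.
have: e n - d n <= e n - d n by []; move: {-2}(e n - d n) => j.
elim: j => // j IH jn; rewrite pmap_mkseqS (IH (ltnW jn)).
by rewrite (@tau_between n) ?leq_addr // -ltn_subRL.
Qed.

(** The weak steps supplied by [step] are concatenated by dependent choice, one transition at a
    time. *)
Lemma Inf_of_weak_steps (I : nat -> state L -> Prop) xi :
  I 0 (init L) ->
  (forall n s, I n s -> exists2 s', weak_path s [:: xi n] s' & I n.+1 s') ->
  Inf L xi.
Proof.
move=> I0 step.
(* A configuration holds the index of the current weak step, its labels still to be executed, and
   the current state. The list is never empty, so every move consumes a label; it may have lost its
   visible label already, hence [<= 1]. *)
pose J (c : nat * seq (option Act) * state L) :=
  [/\ c.1.2 <> [::], size (pmap id c.1.2) <= 1 &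
      exists2 s', fin_path c.2 c.1.2 s' & I c.1.1.+1 s'].
pose S (c c' : nat * seq (option Act) * state L) :=
  exists2 l, trans c.2 l c'.2 &
    (c.1.2 = l :: c'.1.2 /\ c'.1.1 = c.1.1) \/
    [/\ c.1.2 = [:: l], c'.1.1 = c.1.1.+1 & pmap id c'.1.2 = [:: xi c'.1.1]].
have start n s : I n s -> exists2 ls, pmap id ls = [:: xi n] & J (n, ls, s).
  move=> /step[s' [ls lsP ss'] Is']; exists ls => //.
  by split=> /=; [case: ls lsP {ss'}|rewrite lsP|exists s'].
have [ls0 ls0P J0] := start _ _ I0.
have [|c [c0 cJ cS]] := @dependent_choice_inv _ J S _ J0.
  case=> [[n [|l [|l' ls]]] s] [] //= _ le1 [s' [t st ts'] Is'].
    move: ts' Is' => /= <- /start[ls lsP Jt].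
    by exists (n.+1, ls, t) => //; exists l => //; right.
  exists (n, l' :: ls, t); first by exists l => //; left.
  split=> //=; last by exists s'.
  by apply: leq_trans le1; case: (l).
pose l i := head None (c i).1.2.
have cl i : trans (c i).2 (l i) (c i.+1).2.
  by have [l' tl] := cS i; rewrite /l => -[[->]|[->]].
have word i : pmap id (mkseq l i) ++ pmap id (c i).1.2 = mkseq xi (c i).1.1.+1.
  elim: i => [|i IH]; first by rewrite c0.
  rewrite pmap_mkseqS.
  have [l' _ [[E1 E2]|[E1 E2 E3]]] := cS i.
    by rewrite E2 -IH /l E1 /= -catA; case: (l').
  by rewrite E3 E2 mkseqS -cats1 -IH /l E1 /=; case: (l').
exists (fun i => (c i).2), l; split=> //; first by rewrite c0.
apply/visible_wordP; split=> [i|n].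
  by exists (size (pmap id (mkseq l i))); apply: mkseq_prefix (word i).
suff [i ni] : exists i, n <= (c i).1.1.
  exists i; apply: leq_trans ni _; have := congr1 size (word i).
  rewrite size_cat size_mkseq => E; rewrite -ltnS -E -addn1 leq_add2l.
  by have [] := cJ i.
elim: n => [|n [i ni]]; first by exists 0.
(* The pending list shrinks at each move until a new weak step is started, so the index is
   unbounded. *)
suff H m j : size (c j).1.2 <= m -> n <= (c j).1.1 -> exists i, n < (c i).1.1.
  exact: H (leqnn _) ni.
elim: m j => [|m IH] j.
  by rewrite leqn0 => /nilP E; have [] := cJ j.
have [l' _ [[-> E2]|[_ E2 _]]] := cS j => /= sz nj.
  by apply: (IH j.+1); rewrite ?E2.
by exists j.+1; rewrite E2.
Qed.

End InfiniteWords.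

(** * The controller and its composition with [Q] *)

Section Context.
Variables (Act : Type) (g : option Act -> Act) (g_inj : injective g).
Variables (L Q : lts Act) (N : nat).
Implicit Types (sigma : seq Act) (s : state L) (p : state Q).
Local Notation mark := (g None).

(* Both modes record the visible word [sigma] performed so far. [Main f sigma s]
   runs L, the flag telling whether Q is still untouched. In [Drive sigma m j],
   Q has performed j of its N marks, and m bounds the number of visible actions
   still allowed in this mode: without the bound, an infinite word all of whose
   prefixes are in [Tr L] would enter [Inf]. The tau moves out of [Drive] leave
   no stable state there, so [Sf] does not grow. *)
Inductive ctrl : Type :=
| Main of bool & seq Act & state L
| Drive of seq Act & nat & nat.

(** The budget [m] is guessed on entering [Drive]. On exit, L resumes in any state reached by the
    recorded word, and the flag [false] forbids driving [Q] again. *)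
Inductive ctrl_step : ctrl -> option (option Act) -> ctrl -> Prop :=
| MainTau f sigma s s' : trans s None s' ->
    ctrl_step (Main f sigma s) None (Main f sigma s')
| MainVis f sigma s x s' : trans s (Some x) s' ->
    ctrl_step (Main f sigma s) (Some (Some x)) (Main f (rcons sigma x) s')
| MainMark sigma s m : diverges s ->
    ctrl_step (Main true sigma s) (Some None) (Drive sigma m 1)
| DriveWait sigma m j : j < N ->
    ctrl_step (Drive sigma m j) None (Drive sigma m j)
| DriveMark sigma m j : j < N ->
    ctrl_step (Drive sigma m j) (Some None) (Drive sigma m j.+1)
| DriveVis sigma m x : Tr L (rcons sigma x) ->
    ctrl_step (Drive sigma m.+1 N) (Some (Some x)) (Drive (rcons sigma x) m N)
| DriveExit sigma m s : weak_path (init L) sigma s ->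
    ctrl_step (Drive sigma m N) None (Main false sigma s).

Lemma ctrl_step_Main f sigma s o k :
  ctrl_step (Main f sigma s) o k ->
  match o with
  | None => exists2 s', trans s None s' & k = Main f sigma s'
  | Some None => [/\ f, diverges s & exists m, k = Drive sigma m 1]
  | Some (Some x) =>
      exists2 s', trans s (Some x) s' & k = Main f (rcons sigma x) s'
  end.
Proof.
by move=> H; inversion H; subst; [exists s'|exists s'|split=> //; exists m].
Qed.

Lemma ctrl_step_Drive sigma m j o k :
  ctrl_step (Drive sigma m j) o k ->
  match o with
  | None => (j < N /\ k = Drive sigma m j) \/
      (j = N /\ exists2 s, weak_path (init L) sigma s & k = Main false sigma s)
  | Some None => j < N /\ k = Drive sigma m j.+1
  | Some (Some x) => [/\ j = N, Tr L (rcons sigma x) &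
      exists2 m', m = m'.+1 & k = Drive (rcons sigma x) m' N]
  end.
Proof.
move=> H; inversion H; subst; [by left|by []|by split=> //; exists m0|].
by right; split=> //; exists s.
Qed.

Definition ctrl_trans (k : ctrl) (l : option Act) (k' : ctrl) : Prop :=
  exists2 o, omap g o = l & ctrl_step k o k'.

Definition ctrl_alphabet : set Act :=
  [set y | exists2 o, g o = y & if o is Some x then alphabet L x else True].

Lemma ctrl_trans_alphabet k y k' :
  ctrl_trans k (Some y) k' -> ctrl_alphabet y.
Proof.
case=> -[o|] //= [<-] kk'; exists o => //; case: o kk' => // x.
case: k => [f sigma s|sigma m j].
  by move=> /ctrl_step_Main[s' ss' _]; apply: trans_alphabet ss'.
move=> /ctrl_step_Drive[_ sigma_x _]; apply: Tr_alphabet sigma_x _.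
by rewrite -cats1; apply: List.in_or_app; right; left.
Qed.

Definition ctrl_lts : lts Act :=
  Lts (Main true [::] (init L)) ctrl_trans_alphabet.

(* Visible actions of [L] are renamed along [g] to make room for [mark]; the outer
   renaming undoes this. *)
Definition context : lts Act :=
  renaming (hiding (parallel Q ctrl_lts) [set mark])
           [set xy | xy.1 = g (Some xy.2)].

Hypothesis Q_alphabet : alphabet Q = [set mark].
Hypothesis Q_stable : forall p, ~ trans (init Q) None p.
Hypothesis N_gt0 : 0 < N.

Lemma renames_g (y x : Act) :
  renames [set xy | xy.1 = g (Some xy.2)] (g (Some y)) x -> y = x.
Proof. by case=> [/g_inj[]//|[_ []]]; exists y. Qed.

Lemma context_alphabet : alphabet context = alphabet L.
Proof.
apply/seteqP; split=> [x [y [yQK ny] yx]|x Lx] /=.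
  case: yQK => /=; first by rewrite Q_alphabet.
  case=> -[y'|] gy; last by case: ny.
  by move: yx; rewrite -gy => /renames_g ->.
exists (g (Some x)); last by left.
by split=> [|/g_inj //]; right; exists (Some x).
Qed.

(** The only action of [Q] is the hidden [mark], so visible moves belong to the controller alone. *)
Lemma context_visE p k x p' k' :
  trans (l := context) (p, k) (Some x) (p', k') <->
  p' = p /\ ctrl_step k (Some (Some x)) k'.
Proof.
split=> [[y [+ ny] yx]|[-> kk']].
  case=> [[/= + _]|[_ [[/= + _]|[/= -> [[o|//] /= [yo] kk']]]]].
  - by rewrite Q_alphabet => -[/ny].
  - by move=> H; have := trans_alphabet H; rewrite Q_alphabet => /ny.
  case: o yo kk' => [z|] yo kk'; last by case: ny.
  by move: yx; rewrite -yo => /renames_g <-.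
exists (g (Some x)); last by left.
split=> [|/= /g_inj //]; right; split.
  by rewrite /= Q_alphabet => -[/g_inj].
by right; split=> //=; exists (Some (Some x)).
Qed.

Lemma context_tauE p k p' k' :
  trans (l := context) (p, k) None (p', k') <->
  [\/ trans p None p' /\ k' = k, p' = p /\ ctrl_step k None k' |
      trans p (Some mark) p' /\ ctrl_step k (Some None) k'].
Proof.
have joint_mark : joint Q ctrl_lts (Some mark).
  by split; [rewrite Q_alphabet|exists None].
split=> [[[[]//|[_ [[/= pp' ->]|[/= -> [[//|] _ kk']]]]]|[a /= -> H]]|].
- by constructor 1.
- by constructor 2.
- case: H => [[_ [/= pp' [[o|//] [/g_inj -> kk']]]]|[]//].
  by constructor 3.
case=> [[pp' ->]|[-> kk']|[pp' kk']] /=.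
- by left; right; split=> //; left.
- by left; right; split=> //; right; split=> //; exists None.
- by right; exists mark => //; left; split=> //; split=> //; exists (Some None).
Qed.

Definition div_below sigma : Prop :=
  exists u v, sigma = u ++ v /\ Div L u.

Lemma div_below_rcons sigma x : div_below sigma -> div_below (rcons sigma x).
Proof. by move=> [u [v [-> Du]]]; exists u, (rcons v x); rewrite rcons_cat. Qed.

Lemma Div_below sigma : Div L sigma -> div_below sigma.
Proof. by exists sigma, [::]; rewrite cats0. Qed.

(** Invariant of the states reached by [sigma]. Until all [N] marks are done no visible action
    follows the divergent state of L, hence [Div L sigma] when [j < N]; later only a divergent
    prefix is known. *)
Definition reach sigma (c : state context) : Prop :=
  match c.2 with
  | Main true tau s =>
      [/\ tau = sigma, weak_path (init L) sigma s & c.1 = init Q]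
  | Main false tau s =>
      [/\ tau = sigma, weak_path (init L) sigma s, div_below sigma &
          weak_path (init Q) (nseq N mark) c.1]
  | Drive tau _ j =>
      [/\ tau = sigma, Tr L sigma /\ div_below sigma,
          weak_path (init Q) (nseq j mark) c.1,
          j <= N & j < N -> Div L sigma]
  end.

Lemma reach_tau sigma c c' :
  reach sigma c -> trans c None c' -> reach sigma c'.
Proof.
case: c c' => [p k] [p' k'] kR /context_tauE[[pp' ->]|[-> kk']|[pp' kk']].
- case: k kR => [[] tau s|tau m j] /= [].
  + by move=> _ _ /= pQ; move: pp'; rewrite pQ => /Q_stable.
  + by move=> ? ? ? Hp; split=> //; apply: weak_path_taur pp'.
  + by move=> ? ? Hp ? ?; split=> //; apply: weak_path_taur pp'.
- case: k kk' kR => [f tau s|tau m j].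
    move=> /ctrl_step_Main[s' ss' ->] /=; case: f => -[*]; split=> //;
      by apply: weak_path_taur ss'.
  by move=> /ctrl_step_Drive[[_ ->]//|[-> [s ws ->]]] /= [<- [_ D] *]; split.
- case: k kk' kR => [f tau s|tau m j].
    move=> /ctrl_step_Main[-> sD [m ->]] /= [-> sP pQ].
    have D : Div L sigma by exists s.
    split=> //; first by split; [exact: Div_Tr|exact: Div_below].
    by rewrite -pQ; apply: weak_path_vis.
  move=> /ctrl_step_Drive[jN ->] /= [-> ? Hp _ /(_ jN) D]; split=> //.
  by rewrite -[j.+1]addn1 nseqD cats1; apply: weak_path_visr pp'.
Qed.

Lemma reach_vis sigma c x c' :
  reach sigma c -> trans c (Some x) c' -> reach (rcons sigma x) c'.
Proof.
case: c c' => [p k] [p' k'] kR /context_visE[-> kk'].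
case: k kk' kR => [f tau s|tau m j].
  move=> /ctrl_step_Main[s' ss' ->] /=; case: f => -[-> *]; split=> //;
    try exact: weak_path_visr ss'.
  exact: div_below_rcons.
move=> /ctrl_step_Drive[-> Tr_x [m' _ ->]] /= [<- [_ D] *].
by split=> //; [split=> //; exact: div_below_rcons|rewrite ltnn].
Qed.

Lemma reachable sigma c : weak_path (init context) sigma c -> reach sigma c.
Proof.
apply: weak_path_ind; first by split=> //; exact: weak_path0.
  by move=> tau t t' tR tt'; apply: reach_tau tR tt'.
by move=> tau t x t' tR tt'; apply: reach_vis tR tt'.
Qed.

(** A [Drive] state is never stable: it can wait if [j < N], and exit if [j = N], because its
    recorded word is in [Tr L]. *)
Lemma reach_stable sigma p k :
  reach sigma (p, k) -> (forall c', ~ trans (l := context) (p, k) None c') ->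
  exists f s, [/\ k = Main f sigma s, weak_path (init L) sigma s &
    forall s', ~ trans s None s'].
Proof.
case: k => [f tau s|tau m j] kR stable.
  have [E sP] : tau = sigma /\ weak_path (init L) sigma s.
    by case: f kR {stable} => -[].
  exists f, s; rewrite E; split=> // s' ss'; apply: (stable (p, Main f tau s')).
  by apply/context_tauE; constructor 2; split=> //; constructor.
case: kR => <- [[s sP] _] _; rewrite leq_eqVlt => /orP[/eqP jN _|jN _].
  case: (stable (p, Main false tau s)); apply/context_tauE; constructor 2.
  by split=> //; rewrite jN; constructor.
case: (stable (p, Drive tau m j)); apply/context_tauE; constructor 2.
by split=> //; constructor.
Qed.

Lemma weak_path_context s sigma rho s' :
  weak_path s rho s' ->
  weak_path (L := context) (init Q, Main true sigma s) rho
    (init Q, Main true (sigma ++ rho) s').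
Proof.
pose lifted rho s' := weak_path (L := context) (init Q, Main true sigma s) rho
  (init Q, Main true (sigma ++ rho) s').
apply: (@weak_path_ind _ _ s lifted); rewrite /lifted.
- by rewrite cats0; exact: weak_path0.
- move=> tau t t' H tt'; apply: weak_path_taur H _.
  by apply/context_tauE; constructor 2; split=> //; constructor.
- move=> tau t x t' H tt'; apply: weak_path_visr H _.
  by apply/context_visE; split=> //; rewrite -rcons_cat; constructor.
Qed.

Lemma context_Sf : Sf context = Sf L.
Proof.
apply/seteqP; split=> -[sigma A] [ASigma].
  move=> [[p k] /reachable kR [stable refuse]].
  split; first by rewrite -context_alphabet.
  have [f [s [E sP sS]]] := reach_stable kR stable.
  exists s => //; split=> // x s' Ax ss'.
  apply: (refuse x (p, Main f (rcons sigma x) s') Ax).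
  by apply/context_visE; split=> //; rewrite E; constructor.
move=> [s sP [stable refuse]]; split; first by rewrite context_alphabet.
exists (init Q, Main true sigma s); first exact: (weak_path_context [::]) sP.
split=> [[p' k'] /context_tauE|x [p' k'] Ax /context_visE[_ kk']].
  (* A hidden mark would require [s] to diverge, which contradicts its stability. *)
  case=> [[/Q_stable]//|[_ kk']|[_ kk']]; have := ctrl_step_Main kk'.
    by move=> [s' ss' _]; exact: stable ss'.
  by move=> [_ sD _]; have [t st _] := diverges_step sD; apply: stable st.
by have [s' ss' _] := ctrl_step_Main kk'; apply: (refuse x) ss'.
Qed.

(** Within [Main] a run is a run of L. It can be left only under the flag [true], and that flag is
    never regained. *)
Lemma context_Main_path p f sigma s rho p' k' :
  weak_path (L := context) (p, Main f sigma s) rho (p', k') ->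
  (exists2 s', weak_path s rho s' & k' = Main f (sigma ++ rho) s') \/
  (f /\ forall tau t, k' <> Main true tau t).
Proof.
pose I rho (c : state context) :=
  (exists2 s', weak_path s rho s' & c.2 = Main f (sigma ++ rho) s') \/
  (f /\ forall tau t, c.2 <> Main true tau t).
suff H rho' c : weak_path (L := context) (p, Main f sigma s) rho' c -> I rho' c.
  exact: H.
clear rho p' k'; move: rho' c; apply: weak_path_ind; rewrite /I /=.
- by left; exists s; [exact: weak_path0|rewrite cats0].
- move=> tau [q k] [q' k'] /= IH /context_tauE[[_ ->]//|[_ kk']|[_ kk']].
    case: IH kk' => [[t st ->] /ctrl_step_Main[t' tt' ->]|[ftrue nk]].
      by left; exists t' => //; apply: weak_path_taur tt'.
    case: k nk => [[] tau' t|tau' m j] nk; first by case: (nk tau' t).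
      by move=> /ctrl_step_Main[t' tt' ->]; right.
    by move=> /ctrl_step_Drive[[_ ->]|[_ [t _ ->]]]; right.
  case: k kk' IH => [f' tau' t|tau' m j].
    move=> /ctrl_step_Main[-> _ [m ->]] [[t' _ [<- _ _]]|[ftrue _]];
      first by right.
    by right.
  by move=> /ctrl_step_Drive[_ ->] [[t' _ //]|[ftrue _]]; right.
- move=> tau [q k] x [q' k'] /= IH /context_visE[_ kk'].
  case: IH kk' => [[t st ->] /ctrl_step_Main[t' tt' ->]|[ftrue nk]].
    by left; exists t'; [apply: weak_path_visr tt'|rewrite rcons_cat].
  case: k nk => [[] tau' t|tau' m j] nk; first by case: (nk tau' t).
    by move=> /ctrl_step_Main[t' tt' ->]; right.
  by move=> /ctrl_step_Drive[_ _ [m' _ ->]]; right.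
Qed.

(** As long as the mode is [Drive], each visible action lowers the budget by one. *)
Lemma context_Drive_path p sigma m j rho c :
  weak_path (L := context) (p, Drive sigma m j) rho c ->
  (exists tau t, c.2 = Main false tau t) \/
  (exists tau m' j', c.2 = Drive tau m' j' /\ m' + size rho = m).
Proof.
move: rho c; apply: weak_path_ind => /=.
- by right; exists sigma, m, j; rewrite addn0.
- move=> rho [q k] [q' k'] /= IH /context_tauE[[_ ->]//|[_ kk']|[_ kk']].
    case: IH kk' => [[tau [t ->]] /ctrl_step_Main[t' _ ->]|].
      by left; exists tau, t'.
    move=> [tau [m' [j' [-> E]]]] /ctrl_step_Drive[[_ ->]|[_ [t _ ->]]].
      by right; exists tau, m', j'.
    by left; exists tau, t.
  case: IH kk' => [[tau [t ->]] /ctrl_step_Main[]//|].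
  move=> [tau [m' [j' [-> E]]]] /ctrl_step_Drive[_ ->].
  by right; exists tau, m', j'.+1.
- move=> rho [q k] x [q' k'] /= IH /context_visE[_ kk'].
  case: IH kk' => [[tau [t ->]] /ctrl_step_Main[t' _ ->]|].
    by left; exists (rcons tau x), t'.
  move=> [tau [m' [j' [-> <-]]]] /ctrl_step_Drive[_ _ [m'' -> ->]].
  by right; exists (rcons tau x), m'', N; rewrite size_rcons addnS.
Qed.

(** If [Main true] is ever left, the finite budget of [Drive] forces an exit to [Main false], which
    is permanent. *)
Lemma context_eventually_Main (xi : nat -> Act) (c : nat -> state context) :
  (forall n, weak_path (c n) [:: xi n] (c n.+1)) ->
  (exists tau t, (c 0).2 = Main true tau t) ->
  exists n0 f, forall n, n0 <= n -> exists tau t, (c n).2 = Main f tau t.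
Proof.
move=> cP c0.
have [|/existsNP[n nMain]] :=
  EM (forall n, exists tau t, (c n).2 = Main true tau t).
  by exists 0, true.
suff [n0 n0P] : exists n0, exists tau t, (c n0).2 = Main false tau t.
  exists n0, false; elim=> [|m IH].
    by rewrite leqn0 => /eqP <-.
  rewrite leq_eqVlt => /orP[/eqP <- //|/IH[tau [t cm]]].
  move: (cP m) cm; case: (c m) (c m.+1) => [p k] [p' k'] /= + E.
  rewrite E => /context_Main_path[[s' _ ->]|[]//].
  by exists (tau ++ [:: xi m]), s'.
case En: (c n).2 nMain => [[] tau t|tau m j].
- by case; exists tau, t.
- by exists n, tau, t.
- move=> _; elim/ltn_ind: m n tau j En => m IH n tau j En.
  move: (cP n) En; case: (c n) => [p k] /= + E; rewrite E.
  move=> /context_Drive_path[[tau' [t E']]|]; first by exists n.+1, tau', t.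
  move=> [tau' [m' [j' [E' mm']]]]; apply: IH E'.
  by rewrite -mm' addn1.
Qed.

Lemma context_Inf : Inf context = Inf L.
Proof.
apply/seteqP; split=> xi /Inf_weak_steps[c [c0 cP]]; last first.
  apply: (@Inf_of_weak_steps _ context (fun n c' =>
    c' = (init Q, Main true (mkseq xi n) (c n)))); first by rewrite c0.
  move=> n _ ->; exists (init Q, Main true (mkseq xi n.+1) (c n.+1)) => //.
  by rewrite mkseqS -cats1; apply: weak_path_context.
have cR n : reach (mkseq xi n) (c n).
  apply: reachable; elim: n => [|n IH]; first by rewrite c0; exact: weak_path0.
  by rewrite mkseqS -cats1; apply: weak_path_cat IH _.
have [|n0 [f cM]] := context_eventually_Main cP.
  by rewrite c0; exists [::], (init L).
(* Before [n0] the controller may have been driving, so its past gives no step-by-step run of L.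
   Instead [s] is kept on a weak path of L to the state stored at some later time [m]; up to [n0]
   this path comes from [reach]. *)
apply: (@Inf_of_weak_steps _ L (fun n s => exists m tau t,
  [/\ n <= m, n0 <= m, (c m).2 = Main f tau t &
      weak_path s (mkseq (fun i => xi (n + i)) (m - n)) t])).
  have [tau [t E]] := cM n0 (leqnn _); exists n0, tau, t; split=> //.
  by move: (cR n0); rewrite /reach E subn0; case: f {cM E} => -[].
move=> n s [m [tau [t [nm n0m E st]]]].
(* At [n = m] the next step of the context is used; for [n < m] one letter is taken off the stored
   path. *)
move: nm; rewrite leq_eqVlt => /orP[/eqP nm|nm].
  rewrite nm subnn /= in st *.
  have [tau' [t' E']] := cM m.+1 (leqW n0m).
  have tt' : weak_path t [:: xi m] t'.
    move: (cP m) E E'; case: (c m) (c m.+1) => [p k] [p' k'] /= H Ek Ek'.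
    rewrite Ek Ek' in H.
    have [[u tu [_ ->]]//|[ft /(_ tau' t')]] := context_Main_path H.
    by rewrite ft.
  exists t'; first exact: weak_path_cat st tt'.
  exists m.+1, tau', t'; split=> //; first exact: leqW.
  by rewrite subnn; exact: weak_path0.
move: st; rewrite -(subnSK nm) /mkseq /= addn0 -cat1s.
move=> /weak_path_split[u su ut].
exists u => //; exists m, tau, t; split=> //.
move: ut; rewrite (iotaDl 1 0) -map_comp.
by under eq_map => i do rewrite /= addnA addn1.
Qed.

(** If [sigma] is not in [Div L], no mark can occur along the divergence. Either [Q] eventually
    diverges alone, which its stable initial state allows only after all [N] marks, or the
    controller moves infinitely often and yields a divergence of L. *)
Lemma context_Div_elim sigma :
  Div context sigma -> Div L sigma \/
  [/\ Div Q (nseq N mark), Tr L sigma & div_below sigma].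
Proof.
move=> [c cP [path path0 pathP]]; have [|nD] := EM (Div L sigma); first by left.
right; apply: contrapT => nright.
have cR i : reach sigma (path i).
  elim: i => [|i IH]; first by rewrite path0; exact: reachable.
  by apply: reach_tau IH (pathP i).
pose p i := (path i).1; pose k i := (path i).2.
have R i : reach sigma (p i, k i) by rewrite /p /k -surjective_pairing.
(* A controller move ends in [Main]; it is a tau of L if it starts in [Main], and an exit from
   [Drive] otherwise. *)
pose moves i := exists f s', k i.+1 = Main f sigma s' /\
  forall f0 tau s, k i = Main f0 tau s -> f0 = f /\ trans s None s'.
have step i : moves i \/ (k i.+1 = k i /\ trans (p i) None (p i.+1)).
  move: (pathP i) (R i); rewrite /moves /p /k.
  case: (path i) (path i.+1) => [q h] [q' h'] /= + hR.
  move=> /context_tauE[[? ->]|[_ hh']|[_ hh']]; first by right.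
    case: h hh' hR => [f tau s|tau m j].
      move=> /ctrl_step_Main[s' ss' ->] sR; left; exists f, s'; split.
        by case: f sR => -[->].
      by move=> f0 tau0 s0 [<- _ <-].
    move=> /ctrl_step_Drive[[jN _] [_ _ _ _ /(_ jN)]//|[_ [s _ ->]] [-> *]].
    by left; exists false, s.
  case: h hh' hR => [f tau s|tau m j].
    by move=> /ctrl_step_Main[-> sD _] [_ sP _]; case: nD; exists s.
  by move=> /ctrl_step_Drive[jN _] [_ _ _ _ /(_ jN)].
have often i : exists d, moves (i + d).
  apply: contrapT => /forallNP never.
  have pD : diverges (p i).
    exists (fun d => p (i + d)); first by rewrite addn0.
    by move=> d; have [/never//|[_]] := step (i + d); rewrite addnS.
  have [q pq _] := diverges_step pD; apply: nright.
  move: (R i); case: (k i) => [[] tau s|tau m j] /= [].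
  - by move=> _ _ /= E; move: pq; rewrite E => /Q_stable.
  - move=> _ sP D pP; split=> //; first by exists (p i).
    by exists s.
  - move=> _ [? ?] pP; rewrite leq_eqVlt => /orP[/eqP jN _|jN /(_ jN)//].
    by split=> //; exists (p i) => //; rewrite -jN.
have next i : exists2 j, k j = k i & moves j.
  have [d] := often i; elim: d i => [|d IH] i.
    by rewrite addn0; exists i.
  rewrite addnS -addSn => mv; have [|[E _]] := step i; first by exists i.
  by have [j jE jm] := IH _ mv; exists j => //; rewrite jE.
(* From the first controller move on the mode is [Main], so every later move is a tau of L. *)
pose on_path s := exists i f, k i = Main f sigma s.
have [j _ [f [s [Es _]]]] := next 0.
case: nD; exists s.
  by move: (R j.+1); rewrite Es; case: f {Es} => -[].
apply: (@diverges_coind _ _ on_path); first by exists j.+1, f.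
move=> t [i [f' Et]]; have [j' jE [f'' [t' [Et' /(_ f' sigma t)]]]] := next i.
by rewrite jE => /(_ Et)[_ tt']; exists t' => //; exists j'.+1, f''.
Qed.

Lemma Div_context sigma : Div L sigma -> Div context sigma.
Proof.
move=> [s sP [q q0 qP]]; exists (init Q, Main true sigma s).
  exact: (weak_path_context [::]) sP.
exists (fun i => (init Q, Main true sigma (q i))); first by rewrite q0.
by move=> i; apply/context_tauE; constructor 2; split=> //; constructor.
Qed.

Lemma context_drive p ls q sigma m j :
  fin_path p ls q -> pmap id ls = nseq (N - j) mark -> j <= N ->
  weak_path (L := context) (p, Drive sigma m j) [::] (q, Drive sigma m N).
Proof.
elim: ls p j => [|[y|] ls IH] p j /=.
- move=> -> /esym/(congr1 size) /eqP; rewrite size_nseq /= subn_eq0 => Nj jN.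
  have -> : j = N by apply/eqP; rewrite eqn_leq jN.
  exact: weak_path0.
- move=> [p' pp' p'q]; case E: (N - j) => [|d] //= [Ey Els] jN.
  have {}jN : j < N by rewrite -subn_gt0 E.
  rewrite Ey in pp'; apply: (weak_path_cat (sigma := [::])); last first.
    by apply: IH p'q _ jN; rewrite subnS E.
  apply: weak_path_tau; apply/context_tauE; constructor 3.
  by split=> //; constructor.
- move=> [p' pp' p'q] E jN; apply: (weak_path_cat (sigma := [::])); last first.
    exact: IH p'q E jN.
  by apply: weak_path_tau; apply/context_tauE; constructor 1.
Qed.

Lemma context_read p u v : Tr L (u ++ v) ->
  weak_path (L := context) (p, Drive u (size v) N) v (p, Drive (u ++ v) 0 N).
Proof.
elim: v u => [|x v IH] u; first by rewrite cats0 => _; exact: weak_path0.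
rewrite -cat_rcons => uv; apply: (weak_path_cat (sigma := [:: x]) _ (IH _ uv)).
apply: weak_path_vis; apply/context_visE; split=> //; constructor.
exact: Tr_prefix uv.
Qed.

(** The witness follows L along [u] to a divergent state, drives [Q] through its [N] marks, reads
    [v] with budget exactly [size v], and then lets [Q] diverge. *)
Lemma Div_context_below sigma :
  Div Q (nseq N mark) -> Tr L sigma -> div_below sigma -> Div context sigma.
Proof.
move=> [q [ls lsP lsQ] qD] sigmaTr [u [v [E [s sP sD]]]].
move: sigmaTr; rewrite {sigma}E => uv.
exists (q, Drive (u ++ v) 0 N); last first.
  have [path path0 pathP] := qD.
  exists (fun i => (path i, Drive (u ++ v) 0 N)); first by rewrite path0.
  by move=> i; apply/context_tauE; constructor 1.
apply: weak_path_cat (context_read _ uv).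
have sC := weak_path_context [::] sP.
suff H : weak_path (L := context) (init Q, Main true ([::] ++ u) s) [::]
    (q, Drive u (size v) N).
  by have := weak_path_cat sC H; rewrite cats0.
(* The path of [Q] is nonempty as [N > 0] and cannot start with tau; its first mark is the one taken
   by [MainMark]. *)
case: ls lsP lsQ => [|[y|] ls] /=.
- by move=> E; move: N_gt0; rewrite -(size_nseq N mark) -E.
- move=> E [q' Qq' q'q]; apply: (weak_path_cat (sigma := [::])); last first.
    apply: context_drive q'q _ N_gt0.
    by rewrite subn1; case: (N) E => //= n [].
  apply: weak_path_tau; apply/context_tauE; constructor 3; split.
    by move: E N_gt0; case: (N) => //= n [<-].
  by constructor.
- by move=> _ [q' /Q_stable].
Qed.

End Context.

(** * Turning a given word into repetitions of a single action *)

Section Unary.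
Variables (Act : Type) (a : Act).
Implicit Types (X : lts Act) (delta : seq Act).

Definition chain_trans (w : seq Act) (l : option Act) (w' : seq Act) : Prop :=
  if l is Some x then w = x :: w' else False.

(** States are the remaining suffixes. The full alphabet forces every visible action of the partner
    to follow [delta]. *)
Definition chain delta : lts Act :=
  @Lts Act (seq Act) [set: Act] chain_trans delta (fun _ _ _ _ => I).

Definition unary delta X : lts Act :=
  renaming (parallel X (chain delta)) [set xy | xy.2 = a].

Lemma unary_alphabet delta X : alphabet (unary delta X) = [set a].
Proof.
apply/seteqP; split=> [b [y _ [//|[_ []]]]|_ ->]; first by exists a.
by exists a; [right|left].
Qed.

(** The alphabet condition keeps the chain from advancing without [X]. *)
Lemma unary_transE delta X (s s' : state X) w w' l :
  (forall y, List.In y w -> alphabet X y) ->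
  trans (l := unary delta X) (s, w) l (s', w') <->
  match l with
  | None => trans s None s' /\ w' = w
  | Some b => b = a /\ exists2 y, w = y :: w' & trans s (Some y) s'
  end.
Proof.
case: l => [b|] wX /=; last first.
  by split=> [[[]//|[_ [//|[_ []]]]]|[ss' ->]]; right; split=> //; left.
split=> [[y H [/= ->|[_ []]]]|[-> [y yw ss']]]; [split=> //|by exists a|].
  exists y; first by case: H => [[_ []//]|[nj [[/= ss' _]|[_ //]]]];
    case: nj; split=> //; apply: trans_alphabet ss'.
  case: H => [[_ []//]|[nj [[//]|[/= _ yw]]]].
  by case: nj; split=> //; apply: wX; rewrite yw; left.
exists y; last by left.
by left; split; [split=> //; apply: wX; rewrite yw; left|].
Qed.

Lemma unary_path_elim delta X (s s' : state X) w rho w' :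
  (forall y, List.In y w -> alphabet X y) ->
  weak_path (L := unary delta X) (s, w) rho (s', w') ->
  exists u, [/\ w = u ++ w', rho = nseq (size u) a & weak_path s u s'].
Proof.
move=> wX; pose I rho (c : state (unary delta X)) :=
  exists u, [/\ w = u ++ c.2, rho = nseq (size u) a & weak_path s u c.1].
suff H rho' c : weak_path (L := unary delta X) (s, w) rho' c -> I rho' c.
  exact: H.
clear rho s' w'; move: rho' c; apply: weak_path_ind; rewrite /I.
- by exists [::]; split=> //; exact: weak_path0.
- move=> rho [t v] [t' v'] [u [wu -> st]].
  have vX y : List.In y v -> alphabet X y.
    by move=> yv; apply: wX; rewrite wu; apply: List.in_or_app; right.
  move=> /(unary_transE _ _ _ _ vX)[tt' ->].
  by exists u; split=> //; apply: weak_path_taur tt'.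
- move=> rho [t v] b [t' v'] [u [wu -> st]].
  have vX y : List.In y v -> alphabet X y.
    by move=> yv; apply: wX; rewrite wu; apply: List.in_or_app; right.
  move=> /(unary_transE _ _ _ _ vX)[-> [y yv tt']].
  exists (rcons u y); split; first by rewrite cat_rcons -yv.
    by rewrite size_rcons -addn1 nseqD cats1.
  exact: weak_path_visr tt'.
Qed.

Lemma unary_path delta X (s s' : state X) u v :
  (forall y, List.In y (u ++ v) -> alphabet X y) ->
  weak_path s u s' ->
  weak_path (L := unary delta X) (s, u ++ v) (nseq (size u) a) (s', v).
Proof.
move=> uvX su; move: v uvX; pose I u s' := forall v,
  (forall y, List.In y (u ++ v) -> alphabet X y) ->
  weak_path (L := unary delta X) (s, u ++ v) (nseq (size u) a) (s', v).
move: u s' su; apply: (@weak_path_ind _ _ s I); rewrite /I.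
- by move=> v _; exact: weak_path0.
- move=> u t t' IH tt' v uvX; apply: weak_path_taur (IH v uvX) _.
  apply/unary_transE; last by [].
  by move=> y yv; apply: uvX; apply: List.in_or_app; right.
- move=> u t x t' IH tt' v; rewrite cat_rcons => uvX.
  rewrite size_rcons -addn1 nseqD cats1; apply: weak_path_visr (IH _ uvX) _.
  apply/unary_transE; last by split=> //; exists x.
  by move=> y yv; apply: uvX; apply: List.in_or_app; right.
Qed.

Lemma unary_Tr delta X :
  (forall y, List.In y delta -> alphabet X y) ->
  Tr (unary delta X) (nseq (size delta) a) <-> Tr X delta.
Proof.
move=> dX; split=> [[[s w] /(unary_path_elim dX)[u [du E su]]]|[s sP]].
  (* Comparing lengths shows that the chain is exhausted. *)
  have := congr1 size E; rewrite !size_nseq du size_cat => /eqP.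
  rewrite -[X in _ == X]addn0 eqn_add2l => /nilP E'.
  by rewrite E' cats0; exists s.
exists (s, [::]); have := @unary_path delta X (init X) s delta [::].
by rewrite cats0; exact.
Qed.

Lemma prefix_path_elim X rho (c : state (act_prefix a X)) :
  weak_path (init (act_prefix a X)) rho c ->
  (c = None /\ rho = [::]) \/
  exists s rho', [/\ c = Some s, rho = a :: rho' & weak_path (init X) rho' s].
Proof.
move: rho c; apply: weak_path_ind; first by left.
- move=> rho c [t'|] [[-> ->]|[s [rho' [-> -> sP]]]] //=; first by case.
  by move=> st'; right; exists t', rho'; split=> //; apply: weak_path_taur st'.
- move=> rho c x [t'|] [[-> ->]|[s [rho' [-> -> sP]]]] //=.
    move=> [[->] ->]; right; exists (init X), [::]; split=> //.
    exact: weak_path0.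
  move=> st'; right; exists t', (rcons rho' x); split=> //.
  exact: weak_path_visr st'.
Qed.

Lemma prefix_path X rho s : weak_path (init X) rho s ->
  weak_path (init (act_prefix a X)) (a :: rho) (Some s).
Proof.
pose I rho s := weak_path (init (act_prefix a X)) (a :: rho) (Some s).
move: rho s; apply: (@weak_path_ind _ _ _ I); rewrite /I.
- exact: weak_path_vis.
- by move=> rho t t' H tt'; apply: weak_path_taur H _.
- by move=> rho t x t' H tt'; rewrite -rcons_cons; apply: weak_path_visr H _.
Qed.

Lemma prefix_Div X rho : Div (act_prefix a X) (a :: rho) <-> Div X rho.
Proof.
split=> [[c /prefix_path_elim[[//]|[s [rho' [-> [->] sP]]]] cD]|[s sP sD]].
  exists s => //; apply: (@diverges_coind _ _
    (fun t => diverges (L := act_prefix a X) (Some t))) => // t.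
  by move=> /diverges_step[[u|//] tu uD]; exists u.
exists (Some s); first exact: prefix_path.
by have [p p0 pP] := sD; exists (fun i => Some (p i)) => //; rewrite p0.
Qed.

Lemma unary_Div delta X :
  (forall y, List.In y delta -> alphabet X y) ->
  Div (unary delta X) (nseq (size delta) a) <-> Div X delta.
Proof.
move=> dX; split=> [[[s w] /(unary_path_elim dX)[u [du E su]] swD]|[s sP sD]].
  have := congr1 size E; rewrite !size_nseq du size_cat => /eqP.
  rewrite -[X in _ == X]addn0 eqn_add2l => /nilP E'.
  rewrite E' cats0; exists s => //; apply: (@diverges_coind _ _
    (fun t => diverges (L := unary delta X) (t, w))) => // t.
  have wX y : List.In y w -> alphabet X y by rewrite E'.
  move=> /diverges_step[[u' w'] /(unary_transE _ _ _ _ wX)[tu ->] uD].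
  by exists u'.
exists (s, [::]).
  have := @unary_path delta X (init X) s delta [::].
  by rewrite cats0; exact.
have [p p0 pP] := sD; exists (fun i => (p i, [::])); first by rewrite p0.
by move=> i; apply/unary_transE.
Qed.

End Unary.

(** Hilbert's hotel: shifting a sequence [k] of distinct actions frees [k 0] for [None]. This yields
    a fresh mark even when L uses every action. *)
Lemma infinite_option_inj (Act : Type) :
  infinite_set [set: Act] -> exists g : option Act -> Act, injective g.
Proof.
move=> /infiniteP/card_leP[h].
pose k (n : nat) : Act := val (h (SigSub (mem_set (I : [set: nat] n)))).
have k_inj : injective k.
  move=> m n /val_inj/(inj (f := h)) E.
  by have /(congr1 val) := E (in_setT _) (in_setT _).
have [|f fP] := @choice Act Act (fun x y =>
    (forall i, x = k i -> y = k i.+1) /\ ((forall i, x <> k i) -> y = x)).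
  move=> x; have [[i ->]|nx] := EM (exists i, x = k i).
    by exists (k i.+1); split=> [j /k_inj ->|/(_ i)].
  by exists x; split=> // i xi; case: nx; exists i.
have f_cases x : (exists2 i, x = k i & f x = k i.+1) \/
    ((forall i, x <> k i) /\ f x = x).
  have [fk fn] := fP x; have [[i xi]|nx] := EM (exists i, x = k i).
    by left; exists i => //; exact: fk.
  have nx' i : x <> k i by move=> xi; apply: nx; exists i.
  by right; split=> //; exact: fn.
exists (fun o => if o is Some x then f x else k 0) => -[x|] [y|] //.
- have [[i -> ->]|[nx ->]] := f_cases x; have [[j -> ->]|[ny ->]] := f_cases y.
  + by move=> /k_inj[->].
  + by move=> E; case: (ny i.+1).
  + by move=> /nx.
  + by move=> ->.
- by have [[i _ ->]|[nx ->]] := f_cases x; [move=> /k_inj|move=> /nx].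
- have [[i _ ->]|[ny ->]] := f_cases y; first by move=> /k_inj.
  by move=> E; case: (ny 0).
Qed.

(** * Preservation of the alphabet and of [Tr] *)

Section Preservation.
Variables (Act : Type) (R : lts Act -> lts Act -> Prop).
Hypotheses (R_congr : congruence R) (R_Inf : preserves R (@Inf Act)).

Definition loop_trans (a : Act) (s : unit) (l : option Act) (s' : unit) : Prop :=
  l = Some a.

Lemma loop_trans_alphabet a s b s' : loop_trans a s (Some b) s' -> [set a] b.
Proof. by case. Qed.

Definition loop (a : Act) : lts Act := Lts tt (@loop_trans_alphabet a).

(** If [a] were missing from L', the loop could repeat [a] alone beside L'. Beside L the loop must
    synchronise, so L itself would have this infinite trace, and so would L', which lacks [a]. *)
Lemma alphabet_sub L L' : R L L' -> alphabet L `<=` alphabet L'.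
Proof.
move=> LL' a La; apply: contrapT => nL'a.
have aw : visible_word (fun=> Some a) (fun=> a).
  by exists id; split=> // i /(_ i).
have : Inf (parallel L' (loop a)) (fun=> a).
  exists (fun=> (init L', tt)), (fun=> Some a); split=> // i.
  by right; split; [case|right].
rewrite -(R_Inf (congr_parl R_congr (loop a) LL')) => -[p [l [p0 pP lw]]].
have l_a i : l i = None \/ l i = Some a.
  have [e [_ eV eN]] := lw; have [[n ->]|ne] := EM (exists n, i = e n).
    by right.
  by left; apply: eN => n ie; apply: ne; exists n.
have : Inf L (fun=> a).
  exists (fun i => (p i).1), l; split=> //; first by rewrite p0.
  move=> i; have := pP i; have [->|->] := l_a i.
    by case=> [[]//|[_ [[]//|[]//]]].
  by case=> [[_ []]//|[]]; case.
rewrite (R_Inf LL') => -[q [l' [_ qP [e [_ eV _]]]]].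
by have := trans_alphabet (eq_ind _ (fun l => trans _ l _) (qP (e 0)) _ (eV 0)).
Qed.

Section Probe.
Variables (a b : Act) (ab : a <> b) (n : nat).

Definition probe_word (i : nat) : Act := if i < n then a else b.

Definition probe_trans (i : nat) (l : option Act) (i' : nat) : Prop :=
  l = Some (probe_word i) /\ i' = i.+1.

Definition probe : lts Act :=
  @Lts Act nat [set: Act] probe_trans 0 (fun _ _ _ _ => I).

Lemma probe_path X (s s' : state X) ls k i :
  alphabet X = [set a] -> fin_path s ls s' -> pmap id ls = nseq k a ->
  i + k <= n -> fin_path (L := parallel X probe) (s, i) ls (s', i + k).
Proof.
move=> Xa; elim: ls s k i => [|[x|] ls IH] s k i /=.
- by move=> -> /(congr1 size) /=; rewrite size_nseq => <-; rewrite addn0.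
- move=> [t st ts']; case: k => // k [xa lsk] ikn.
  exists (t, i.+1); last by rewrite -addSnnS; apply: IH => //; rewrite addSnnS.
  left; split; first by rewrite xa /= Xa.
  split=> //=; split=> //; rewrite /probe_word xa ifT //.
  by apply: leq_trans ikn; rewrite addnS ltnS leq_addr.
- move=> [t st ts'] lsk ikn; exists (t, i); last exact: IH.
  by right; split=> //; left.
Qed.

(** A finite trace becomes an infinite one: [X] must join the first [n] actions [a], after which the
    probe repeats [b] alone, as [b] is outside the alphabet of [X]. *)
Lemma Inf_probe X : alphabet X = [set a] ->
  Tr X (nseq n a) <-> Inf (parallel X probe) probe_word.
Proof.
move=> Xa; split=> [[s sP]|/Inf_weak_steps[c [c0 cP]]].
  apply: (@Inf_of_weak_steps _ (parallel X probe) (fun i c =>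
    c.2 = i /\ weak_path c.1 (nseq (n - i) a) s)); first by rewrite subn0.
  move=> i [t j] [/= -> ts] {j}; rewrite /probe_word.
  have [lt_in|le_ni] := ltnP i n.
    move: ts; rewrite -(subnSK lt_in) -[nseq _ _]/([:: a] ++ nseq _ a).
    move=> /weak_path_split[t' [ls lsP tt'] t's].
    exists (t', i + 1); last by rewrite addn1.
    by exists ls => //; apply: probe_path; rewrite ?addn1.
  exists (t, i.+1); last first.
    by split=> //=; move: ts; rewrite (eqP le_ni) (eqP (leqW le_ni)).
  apply: weak_path_vis; right; split; first by rewrite /= Xa => -[/esym].
  by right; split=> //; split=> //; rewrite /probe_word ltnNge le_ni.
pose I (rho : seq Act) (c : state (parallel X probe)) :=
  c.2 = size rho /\ (size rho <= n -> weak_path (init X) (nseq (size rho) a) c.1).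
have H : forall rho c, weak_path (init (parallel X probe)) rho c -> I rho c.
  apply: weak_path_ind; rewrite /I.
  - by split=> // _; exact: weak_path0.
  - move=> rho [s i] [s' i'] [/= -> sP] [[]//|[_ [[/= ss' ->]|[_ []//]]]].
    by split=> // /sP{}sP; apply: weak_path_taur ss'.
  - move=> rho [s i] x [s' i'] [/= -> sP]; rewrite size_rcons.
    case=> [[[Xx _] [/= ss' [_ ->]]]|[nj [[/= ss' _]|[/= -> [[xE] ->]]]]].
    + split=> // lt_n; rewrite -[_ :: _]/(nseq (size rho).+1 a).
      rewrite -addn1 nseqD cats1.
      apply: weak_path_visr (sP (ltnW lt_n)) _.
      by move: Xx ss'; rewrite Xa => ->.
    + by case: nj; split=> //; apply: trans_alphabet ss'.
    + split=> // lt_n; case: nj; split=> //.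
      by rewrite Xa xE /probe_word lt_n.
have /H[_] : weak_path (init (parallel X probe)) (mkseq probe_word n) (c n).
  elim: (n) => [|m IH]; first by rewrite c0; exact: weak_path0.
  by rewrite mkseqS -cats1; apply: weak_path_cat IH _.
by rewrite size_mkseq => /(_ (leqnn _)); exists (c n).1.
Qed.

End Probe.

(** Membership of [sigma] in [Tr] is encoded as an infinite trace of a context built from [unary]
    and [probe], and [R] preserves [Inf] in contexts. *)
Lemma Tr_sub (a b : Act) L L' : a <> b -> R L L' -> Tr L `<=` Tr L'.
Proof.
move=> ab LL' sigma Ls.
have sL y : List.In y sigma -> alphabet L y by apply: Tr_alphabet Ls.
have sL' y : List.In y sigma -> alphabet L' y.
  by move=> /sL; apply: alphabet_sub LL' _.
apply/(unary_Tr a sL')/(Inf_probe ab _ (unary_alphabet _ _ _)).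
have := congr_parl R_congr (probe a b (size sigma)) (congr_renaming R_congr
  [set xy | xy.2 = a] (congr_parl R_congr (chain sigma) LL')).
move=> /R_Inf <-; apply/(Inf_probe ab _ (unary_alphabet _ _ _)).
exact/unary_Tr.
Qed.

End Preservation.

(** * Minimal divergence traces and the final argument *)

Lemma div_below_minD (Act : Type) (L : lts Act) sigma :
  div_below L sigma <-> exists u v, sigma = u ++ v /\ minD L u.
Proof.
(* A shortest divergent prefix is minimal; it is found by induction on the length of [u]. *)
split=> [[u]|[u [v [-> [uD _]]]]]; last by exists u, v.
elim/ltn_ind: {u}(size u) {-2}u (erefl (size u)) => n IH u un [v [E uD]].
have [[i [iu iD]]|min_u] := EM (exists i, i < size u /\ Div L (take i u)).
  apply: (IH (size (take i u)) _ (take i u) erefl).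
    by rewrite -un size_takel // ltnW.
  by exists (drop i u ++ v); rewrite catA cat_take_drop.
by exists u, v; do 2!split=> //; move=> i iu iD; apply: min_u; exists i.
Qed.

Theorem theorem6p14 (Act : Type) (Act_infinite : infinite_set [set: Act])
    (R : lts Act -> lts Act -> Prop) (R_congr : congruence R)
    (R_cffd : forall L L' : lts Act, cffd_equiv L L' -> R L L')
    (R_Sf : preserves R (@Sf Act))
    (R_minD : preserves R (@minD Act))
    (R_Inf : preserves R (@Inf Act))
    (R_Div : ~ preserves R (@Div Act)) :
  forall L L' : lts Act,
    R L L' <->
    [/\ alphabet L = alphabet L', Tr L = Tr L', Sf L = Sf L',
        minD L = minD L' & Inf L = Inf L'].
Proof.
have [R_refl R_sym R_trans] := congr_equiv R_congr.
have [g g_inj] := infinite_option_inj Act_infinite.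
pose a := g None.
have ab : a <> g (Some a) by move=> /g_inj.
move=> L L'; split=> [LL'|[eqA eqTr eqSf eqminD eqInf]].
  have L'L := R_sym _ _ LL'.
  split; [| |exact: R_Sf|exact: R_minD|exact: R_Inf]; apply/seteqP; split.
  - exact: (alphabet_sub R_congr R_Inf LL').
  - exact: (alphabet_sub R_congr R_Inf L'L).
  - exact: (Tr_sub R_congr R_Inf ab LL').
  - exact: (Tr_sub R_congr R_Inf ab L'L).
have [P [P' [delta [PP' PD P'D]]]] : exists P P' delta,
    [/\ R P P', Div P delta & ~ Div P' delta].
  apply: contrapT => none; apply: R_Div => P P' PP'.
  apply/seteqP; split=> delta D; apply: contrapT => nD; apply: none.
    by exists P, P', delta.
  by exists P', P, delta; split=> //; exact: R_sym.
(* The prefix makes the initial state stable and costs one extra mark, hence [(size delta).+1]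
   marks. *)
pose Q X := act_prefix a (unary a delta X).
pose C K X := context g K (Q X) (size delta).+1.
have QA X : alphabet (Q X) = [set g None].
  rewrite -[LHS]/(alphabet (unary a delta X) `|` [set a]).
  by rewrite unary_alphabet setUid.
have QS X p : ~ trans (init (Q X)) None p by case: p => //= p [].
have CC K : R (C K P) (C K P').
  apply: congr_renaming => //; apply: congr_hiding => //; apply: congr_parl => //.
  apply: congr_prefix => //; apply: congr_renaming => //; exact: congr_parl.
have dP y : List.In y delta -> alphabet P y by apply: Tr_alphabet (Div_Tr PD).
have dP' y : List.In y delta -> alphabet P' y.
  by move=> /dP; exact: (alphabet_sub R_congr R_Inf PP').
have QPD : Div (Q P) (nseq (size delta).+1 (g None)).
  by apply/prefix_Div/unary_Div.
have QP'D : ~ Div (Q P') (nseq (size delta).+1 (g None)).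
  by move=> /prefix_Div/(unary_Div a dP').
(* With P' only [Div] could change, and it does not, since [Q P'] cannot diverge after all its
   marks. *)
have KC K : R K (C K P').
  apply: R_cffd; split.
  - by rewrite /C context_alphabet.
  - by rewrite /C context_Sf.
  - apply/seteqP; split=> sigma; first exact: Div_context.
    move=> /(context_Div_elim g_inj (QA _) (QS _) (ltn0Sn _))[//|[QD]].
    by case: (QP'D QD).
  - by rewrite /C context_Inf.
have CPD K : Div (C K P) = [set sigma | Tr K sigma /\ div_below K sigma].
  apply/seteqP; split=> sigma.
    move=> /(context_Div_elim g_inj (QA _) (QS _) (ltn0Sn _))[D|[_ *] //].
    by split; [exact: Div_Tr|exact: Div_below].
  by case; exact: Div_context_below.
(* The chain of related systems is L, [C L P'], [C L P], [C L' P], [C L' P'], L'; its middle link is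
   a CFFD-equivalence. *)
apply: (R_trans _ _ _ (KC L)); apply: (R_trans _ _ _ (R_sym _ _ (CC L))).
apply: (R_trans _ (C L' P)); last first.
  by apply: (R_trans _ _ _ (CC L')); exact/R_sym/KC.
apply: R_cffd; split.
- by rewrite /C !context_alphabet.
- by rewrite /C !context_Sf.
- rewrite !CPD eqTr; apply/seteqP.
  split=> sigma [Ts /div_below_minD[u [v [E D]]]]; split=> //; apply/div_below_minD; exists u, v; split=> //.
    by rewrite -eqminD.
  by rewrite eqminD.
- by rewrite /C !context_Inf.
Qed.
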